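(* The following deterministic preemptive online algorithm for $\textsc{Part}$ is $2$-competitive for every $p\ge 2$: maintain current partition weights $w_1,\dots,w_p$ (initially all $0$), the current total weight $S$ (initially $0$) and the current maximum request $m$ (initially $0$); upon each request $x$, set $S\gets S+x$, $m\gets\max\{m,x\}$, $B\gets 2\max\{m,S/p\}$, run $\textsc{Probe}(B)$ on the sequence $w_1,w_2,\dots,w_p,x$ (treating each current partition weight as a single element), and take the resulting groups as the new partitions, i.e. current partitions grouped together by $\textsc{Probe}$ are merged by removing the separators between them, and $x$ is appended to the last group or forms a new partition.
   Context: $\textsc{Part}$: given a sequence $w_1,\dots,w_n$ of positive integers and $p\ge2$, place $p-1$ separators to split it into $p$ contiguous blocks minimizing the maximum block weight (the bottleneck value). Preemptive online model: $p$ is known, requests arrive one by one ($n$ unknown); when processing the current request the algorithm may remove previously placed separators, may insert separators only right after the current request, and never has more than $p-1$ separators in place. $\textsc{Probe}(B)$ traverses a sequence left to right, greedily adding elements to the current partition while its weight stays at most $B$ and otherwise starting a new partition. An algorithm is $c$-competitive if on every input its final bottleneck value is at most $c$ times the optimal bottleneck value.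
   Formalization: The rule ''insert separators only right after the current request'' is read as allowing, when x is processed, a new separator only right before x (after the previous request); under the literal timing rule the algorithm is not legal (p=3, requests 2,1,2,2,2,2,1). *)

(* Defs.v *)
(* MathComp; requests and block weights are natural numbers, the bound B and
   the competitive ratio are rationals. *)
From mathcomp Require Import all_boot all_order all_algebra.

Set Implicit Arguments.
Unset Strict Implicit.
Unset Printing Implicit Defensive.

Import Order.TTheory GRing.Theory Num.Theory.

Definition positive_requests (w : seq nat) : bool := all (ltn 0) w.

(* A separator is encoded by the number of requests that precede it: position i
   is the gap right after the i-th request.  The nondecreasing list D cuts w
   into size D + 1 contiguous blocks, a block being the requests between two
   consecutive elements of 0, D, size w. *)
Definition bottleneck (w D : seq nat) : nat :=
  \max_(b <- zip (0 :: D) (rcons D (size w)))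
     \sum_(b.1 <= i < b.2) nth 0 w i.

(* Minimum over all ways to place p - 1 separators; blocks may be empty, so the
   minimum makes sense even if w has fewer than p requests.  The default value
   sumn w is the bottleneck obtained with all separators after the last
   request, hence it does not affect the minimum. *)
Definition opt (p : nat) (w : seq nat) : nat :=
  \big[minn/sumn w]_(D : p.-1.-tuple 'I_(size w).+1 |
                     sorted leq [seq val i | i <- D])
     bottleneck w [seq val i | i <- D].

(* A deterministic online algorithm maps each prefix of the input to the
   separators in place once that prefix has been processed; it therefore cannot
   depend on future requests or on the length of the input. *)
Definition online_algorithm := seq nat -> seq nat.

(* When x is revealed after w, old separators may be removed, and the only one
   that may be inserted is at the current end of the processed sequence, right
   after the last request of w (so that x opens a new block). Separators not in
   place are irrelevant to the bottleneck, as they would only bound empty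
   blocks. *)
Definition preemptive (p : nat) (A : online_algorithm) : Prop :=
  (forall w, positive_requests w ->
     [/\ sorted ltn (A w), all (fun i => 0 < i <= size w) (A w)
       & size (A w) <= p.-1])
  /\ (forall w x, positive_requests (rcons w x) ->
     {subset A (rcons w x) <= size w :: A w}).

Definition competitive (c : rat) (p : nat) (A : online_algorithm) : Prop :=
  forall w, positive_requests w ->
    ((bottleneck w (A w))%:R <= c * (opt p w)%:R)%R.

(* The partitions built by Probe(B) on a sequence of elements weighted by wt;
   cur is the partition under construction. *)
Fixpoint probe_from (T : Type) (wt : T -> nat) (B : rat) (cur s : seq T)
    : seq (seq T) :=
  if s is y :: s' then
    if ((\sum_(z <- rcons cur y) wt z)%:R <= B)%R
    then probe_from wt B (rcons cur y) s'
    else cur :: probe_from wt B [:: y] s'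
  else [:: cur].

Definition probe (T : Type) (wt : T -> nat) (B : rat) (s : seq T)
    : seq (seq T) :=
  probe_from wt B [::] s.

(* The state keeps the current partitions themselves rather than only their
   weights w_1, ..., w_p, which are the values of sumn on the blocks. *)
Record state := State {
  blocks : seq (seq nat);
  total : nat;
  max_request : nat
}.

Definition init (p : nat) : state := State (nseq p [::]) 0 0.

(* The elements given to Probe are the blocks, each with its weight sumn, and
   then the block [:: x].  Merging a group of blocks is flatten.  Unused
   partitions are empty blocks (of weight 0) at the end of the list. *)
Definition step (p : nat) (st : state) (x : nat) : state :=
  let S := total st + x in
  let m := maxn (max_request st) x in
  let B : rat := (2 * Num.max m%:R (S%:R / p%:R))%R in
  let bs := map flatten (probe sumn B (rcons (blocks st) [:: x])) in
  State (bs ++ nseq (p - size bs) [::]) S m.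

(* The separators between consecutive nonempty blocks: interior partial sums
   of the block lengths. *)
Definition separators (bs : seq (seq nat)) : seq nat :=
  [seq i <- scanl addn 0 (shape bs) | 0 < i < size (flatten bs)].

Definition online_probe (p : nat) : online_algorithm :=
  fun w => separators (blocks (foldl (step p) (init p) w)).

(* Main.v *)
(** Let [B = 2 * max m (S / p)].  Two consecutive groups built by [Probe(B)]
    weigh more than [B] together, so [k] groups satisfy [(k - 1) * B < 2 * S];
    as [p * B >= 2 * S], this gives [k <= p]: the algorithm never needs more
    than [p] partitions.  Since [B] never decreases, the partitions already
    built always fit in it.  Conversely [m] and [S / p] are both lower bounds
    on the optimal bottleneck, so every partition weighs at most [2 * opt]. *)

Require Import Defs.
From mathcomp Require Import all_boot all_order all_algebra.
From mathcomp Require Import zify lra.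

Set Implicit Arguments.
Unset Strict Implicit.
Unset Printing Implicit Defensive.

Import Order.TTheory GRing.Theory Num.Theory.

Lemma flatten_nseq_nil (T : Type) (k : nat) :
  flatten (nseq k [::]) = [::] :> seq T.
Proof. by elim: k. Qed.

Lemma flatten_flatten (T : Type) (sss : seq (seq (seq T))) :
  flatten (flatten sss) = flatten (map flatten sss).
Proof. by elim: sss => //= ss sss <-; rewrite flatten_cat. Qed.

(** * Probe *)

Lemma flatten_probe_from (T : Type) (wt : T -> nat) (B : rat) (cur s : seq T) :
  flatten (probe_from wt B cur s) = cur ++ s.
Proof.
elim: s cur => [|y s IHs] cur /=; first by [].
by case: ifP => _ /=; rewrite IHs ?cat_rcons.
Qed.

Lemma probe_from_le (T : Type) (wt : T -> nat) (B : rat) (cur s : seq T) :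
  ((\sum_(z <- cur) wt z)%:R <= B)%R ->
  all (fun y => ((wt y)%:R <= B)%R) s ->
  all (fun g => ((\sum_(z <- g) wt z)%:R <= B)%R) (probe_from wt B cur s).
Proof.
elim: s cur => [|y s IHs] cur /= curB; first by rewrite curB.
case/andP=> yB sB; case: ifP => fits; first exact: IHs.
by rewrite /= curB IHs // big_seq1.
Qed.

(** A group is closed only on overflow. Since [cur] and the next element each fit in [B] alone, both
    then have positive weight. Hence the zero-weight padding never forms a group of its own. *)
Lemma probe_from_gt0 (T : Type) (wt : T -> nat) (B : rat) (cur s : seq T) :
  ((\sum_(z <- cur) wt z)%:R <= B)%R ->
  all (fun y => ((wt y)%:R <= B)%R) s ->
  0 < \sum_(z <- cur ++ s) wt z ->
  all (fun g => 0 < \sum_(z <- g) wt z) (probe_from wt B cur s).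
Proof.
elim: s cur => [|y s IHs] cur /= curB; first by rewrite cats0 => _ ->.
case/andP=> yB sB gt0; case: ifP => fits; first by rewrite IHs ?cat_rcons.
move: fits; rewrite big_rcons /= => fits.
have cur_gt0 : 0 < \sum_(z <- cur) wt z.
  by rewrite lt0n; apply: contraFN fits => /eqP->; rewrite add0n.
have y_gt0 : 0 < wt y.
  by rewrite lt0n; apply: contraFN fits => /eqP->; rewrite addn0.
by rewrite cur_gt0 IHs ?big_seq1 // big_cons ltn_addr.
Qed.

(** The weight of [cur] on the left carries the pairing of consecutive groups through the induction:
    closing [cur] costs one more [B], which is less than the weight of [cur] plus that of [y].
    Positivity of the total makes the base case strict. *)
Lemma size_probe_from (T : Type) (wt : T -> nat) (B : rat) (cur s : seq T) :
  ((\sum_(z <- cur) wt z)%:R <= B)%R ->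
  all (fun y => ((wt y)%:R <= B)%R) s ->
  0 < \sum_(z <- cur ++ s) wt z ->
  ((size (probe_from wt B cur s)).-1%:R * B + (\sum_(z <- cur) wt z)%:R
     < 2 * (\sum_(z <- cur ++ s) wt z)%:R)%R.
Proof.
elim: s cur => [|y s IHs] cur /= curB.
  by rewrite cats0 mul0r add0r -natrM ltr_nat => _; lia.
case/andP=> yB sB gt0; case: ifP => fits.
  have:= IHs _ fits sB; rewrite cat_rcons => /(_ gt0).
  apply: le_lt_trans; rewrite lerD2l ler_nat big_rcons /=; lia.
move: fits => /negbT; rewrite -ltNge big_rcons /= => fits.
have y_gt0 : 0 < wt y.
  rewrite lt0n; apply: contraTN fits => /eqP->.
  by rewrite addn0 -leNgt.
have := IHs [:: y]; rewrite !big_seq1 => /(_ yB sB).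
rewrite big_cons ltn_addr // => /(_ isT).
rewrite big_cat big_cons /=.
(* The remaining output contains [y], so it is nonempty and its [.-1] is a true predecessor. *)
have := flatten_probe_from wt B [:: y] s.
case: probe_from => // g gs _ /=.
rewrite -natr1 !natrD in fits *.
set c := (\sum_(z <- cur) _)%:R%R in fits *.
by move: fits; lra.
Qed.

(** * Separators *)

Lemma scanl_addn_nseq0 (a k : nat) : scanl addn a (nseq k 0) = nseq k a.
Proof. by elim: k => //= k; rewrite addn0 => ->. Qed.

Lemma mem_scanl_addn (a i : nat) (s : seq nat) :
  i \in scanl addn a s -> exists k, i = a + sumn (take k s).
Proof.
elim: s a => //= x s IHs a; rewrite inE => /predU1P[->|/IHs[k ->]].
  by exists 1; rewrite /= take0 addn0.
by exists k.+1; rewrite /= addnA.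
Qed.

Lemma scanl_addn_mem (a k : nat) (s : seq nat) :
  a + sumn (take k s) \in a :: scanl addn a s.
Proof.
elim: s a k => [|x s IHs] a [|k]; rewrite /= ?addn0 ?mem_head //.
by rewrite addnA inE IHs orbT.
Qed.

(** Describing separators as lengths of block prefixes makes boundaries before and after a merge
    comparable. A zero or oversize [k] yields an end of the sequence, which the range of [i]
    excludes. *)
Lemma mem_separators (bs : seq (seq nat)) (i : nat) :
  reflect (exists2 k, i = size (flatten (take k bs)) & 0 < i < size (flatten bs))
          (i \in separators bs).
Proof.
rewrite mem_filter; apply: (iffP andP) => [[ib /mem_scanl_addn[k ik]]|[k ik ib]].
  by exists k; rewrite // ik size_flatten /shape map_take.
split=> //; have := scanl_addn_mem 0 k (shape bs).
rewrite add0n /shape -map_take -/(shape _) -size_flatten -ik inE.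
by case/predU1P=> [i0|//]; rewrite i0 in ib.
Qed.

Lemma foldl_addn (a : nat) (s : seq nat) : foldl addn a s = a + sumn s.
Proof. by elim: s a => [|x s IHs] a /=; rewrite ?addn0 // IHs addnA. Qed.

(** Padding only repeats the total length among the partial sums, and the filter drops that
    value. *)
Lemma separators_cat_nseq (bs : seq (seq nat)) (k : nat) :
  separators (bs ++ nseq k [::]) = separators bs.
Proof.
rewrite /separators flatten_cat flatten_nseq_nil cats0 /shape map_cat map_nseq /=.
rewrite scanl_cat scanl_addn_nseq0 filter_cat -[RHS]cats0; congr (_ ++ _).
by rewrite foldl_addn add0n size_flatten filter_nseq ltnn andbF.
Qed.

Lemma path_scanl_addn (a : nat) (s : seq nat) :
  all (ltn 0) s -> path ltn a (scanl addn a s).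
Proof.
elim: s a => //= x s IHs a /andP[x0 s0].
by rewrite IHs // andbT -[ltnLHS]addn0 ltn_add2l.
Qed.

(** For nonempty blocks the partial sums increase strictly from a positive value, so the filter
    removes exactly the last one, the total length. *)
Lemma rcons_separators (bs : seq (seq nat)) :
  all (fun b => 0 < size b) bs -> 0 < size bs ->
  rcons (separators bs) (size (flatten bs)) = scanl addn 0 (shape bs).
Proof.
move=> bs0; have: path ltn 0 (scanl addn 0 (shape bs)).
  by apply: path_scanl_addn; rewrite all_map.
case/lastP: bs bs0 => // bs b _ + _; rewrite /separators size_flatten.
rewrite /shape map_rcons -cats1 scanl_cat /= foldl_addn add0n sumn_cat /= addn0 cats1.
set n := _ + size b => path_s.
have /all_filterP filt : all (fun i => 0 < i < n) (scanl addn 0 (shape bs)).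
  move: path_s; rewrite path_sortedE; last exact: ltn_trans.
  rewrite all_rcons => /andP[/andP[_ gt0]].
  rewrite sorted_pairwise; last exact: ltn_trans.
  rewrite pairwise_rcons => /andP[ltn_n _].
  by rewrite (eq_all (a2 := predI (ltn 0) (ltn^~ n))) // all_predI gt0.
by rewrite filter_rcons ltnn andbF filt.
Qed.

(** Separators are absolute positions, so the induction moves each treated block into [pre]. *)
Lemma max_scanl_sum (pre : seq nat) (bs : seq (seq nat)) (M : nat) :
  all (fun b => sumn b <= M) bs ->
  let s := scanl addn (size pre) (shape bs) in
  \max_(b <- zip (belast (size pre) s) s)
     \sum_(b.1 <= i < b.2) nth 0 (pre ++ flatten bs) i <= M.
Proof.
elim: bs pre => [|b bs IHbs] pre /=; first by rewrite big_nil.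
case/andP=> bM /(IHbs (pre ++ b)); rewrite /= size_cat -catA big_cons geq_max /=.
move=> ->; rewrite andbT.
have -> : \sum_(size pre <= i < size pre + size b) nth 0 (pre ++ b ++ flatten bs) i
    = sumn b.
  rewrite -{1}[size pre]add0n big_addn addKn sumnE [RHS](big_nth 0).
  apply: eq_big_nat => i /andP[_ ib].
  by rewrite nth_cat ltnNge leq_addl addnK nth_cat ib.
by [].
Qed.

Lemma bottleneck_separators (bs : seq (seq nat)) (M : nat) :
  all (fun b => 0 < size b) bs -> all (fun b => sumn b <= M) bs ->
  bottleneck (flatten bs) (separators bs) <= M.
Proof.
case: bs => [|b bs] bs0 bsM.
  by rewrite /bottleneck /= big_seq1 big_geq.
(* The left ends [0 :: D] are the [belast] of the right ends [rcons D n], the form used in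
   [max_scanl_sum]. *)
rewrite /bottleneck -(belast_rcons 0 _ (size (flatten (b :: bs)))).
rewrite rcons_separators //; exact: (max_scanl_sum [::] bsM).
Qed.

(** * Lower bounds on the optimum *)

Lemma sum_blocks (F : nat -> nat) (a n : nat) (D : seq nat) :
  path leq a D -> last a D <= n ->
  \sum_(b <- zip (a :: D) (rcons D n)) \sum_(b.1 <= i < b.2) F i
    = \sum_(a <= i < n) F i.
Proof.
elim: D a => [|d D IHD] a /=; first by rewrite big_seq1.
case/andP=> ad dD Dn; rewrite big_cons IHD //= -big_cat_nat //=.
apply: leq_trans Dn; have := mem_last d D; rewrite inE => /predU1P[-> //|].
exact: allP (order_path_min leq_trans dD) _.
Qed.

Lemma leq_max_blocks (F : nat -> nat) (a n i : nat) (D : seq nat) :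
  a <= i < n ->
  F i <= \max_(b <- zip (a :: D) (rcons D n)) \sum_(b.1 <= j < b.2) F j.
Proof.
elim: D a => [|d D IHD] a /= ain.
  by rewrite big_seq1 (bigD1_seq i) ?mem_index_iota ?iota_uniq //= leq_addr.
rewrite big_cons leq_max; case: (ltnP i d) => [id|di].
  case/andP: ain => ai _.
  by rewrite (bigD1_seq i) ?mem_index_iota ?ai ?iota_uniq //= leq_addr.
by case/andP: ain => _ ?; rewrite IHD ?di ?orbT.
Qed.

Lemma sum_leq_size_max (I : eqType) (r : seq I) (F : I -> nat) :
  \sum_(b <- r) F b <= size r * \max_(b <- r) F b.
Proof.
rewrite mulnC -sum1_size big_distrr /= big_seq [leqRHS]big_seq.
by apply: leq_sum => b br; rewrite muln1 leq_bigmax_seq.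
Qed.

Lemma opt_ge (p : nat) (w : seq nat) :
  0 < p -> \max_(x <- w) x <= opt p w /\ sumn w <= p * opt p w.
Proof.
move=> p0; have max_le (M : nat) : (forall i, i < size w -> nth 0 w i <= M) ->
    \max_(x <- w) x <= M.
  by move=> wM; apply/bigmax_leqP_seq => x /(nthP 0)[i iw <-] _; apply: wM.
(* Both bounds survive [minn], so it remains to check the default [sumn w] and each placement of
   separators. *)
apply: (big_ind (fun v => \max_(x <- w) x <= v /\ sumn w <= p * v)).
- split; last by rewrite leq_pmull.
  by apply/bigmax_leqP_seq => x xw _; rewrite sumnE (big_rem x) //= leq_addr.
- by move=> u v [? ?] [? ?]; rewrite /minn; case: ifP.
move=> D sortD; rewrite /bottleneck; split.
  by apply: max_le => i iw; apply: leq_max_blocks.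
have sizeD : size [seq val i | i <- D] = p.-1 by rewrite size_map size_tuple.
have lastD : last 0 [seq val i | i <- D] <= size w.
  have : all (leq^~ (size w)) [seq val i | i <- D].
    by rewrite all_map; apply/allP => i _ /=; rewrite -ltnS.
  by case: [seq _ | _ <- _] => // d s /allP; apply; apply: mem_last.
have pathD : path leq 0 [seq val i | i <- D].
  by move: sortD; case: [seq _ | _ <- _].
rewrite sumnE (big_nth 0) -(sum_blocks _ pathD lastD).
apply: leq_trans (sum_leq_size_max _ _) _.
(* The [p.-1] separators cut out [p] blocks, so the sum is at most [p] times the maximum. *)
by rewrite size_zip size_rcons /= minnn sizeD prednK.
Qed.

(** * The algorithm *)

Definition threshold (p S m : nat) : rat :=
  (2 * Num.max m%:R (S%:R / p%:R))%R.

Lemma threshold_mono (p S S' m m' : nat) :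
  S <= S' -> m <= m' -> (threshold p S m <= threshold p S' m')%R.
Proof.
move=> leS lem; rewrite /threshold ler_pM2l // ge_max !le_max.
by rewrite ler_nat lem /= ler_wpM2r ?invr_ge0 // ?ler_nat ?leS ?orbT.
Qed.

Lemma max_le_threshold (p S m : nat) : (m%:R <= threshold p S m)%R.
Proof.
have := ler0n rat m; have : (m%:R <= Num.max m%:R (S%:R / p%:R) :> rat)%R.
  by rewrite le_max lexx.
by rewrite /threshold; lra.
Qed.

Lemma total_le_threshold (p S m : nat) :
  0 < p -> (2 * S%:R <= p%:R * threshold p S m)%R.
Proof.
move=> p0; rewrite /threshold mulrCA ler_pM2l // mulrC -ler_pdivrMr ?ltr0n //.
by rewrite le_max lexx orbT.
Qed.

Lemma threshold_le_opt (p : nat) (w : seq nat) : 0 < p ->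
  (threshold p (sumn w) (\max_(x <- w) x) <= (2 * opt p w)%:R)%R.
Proof.
move=> p0; have [max_opt sum_opt] := opt_ge w p0.
rewrite /threshold natrM ler_pM2l // ge_max ler_nat max_opt /=.
by rewrite ler_pdivrMr ?ltr0n // -natrM ler_nat mulnC.
Qed.

(** [inv_le] lets the current blocks serve as elements of the next Probe. In [inv_shape] the bound
    [size bs <= p] keeps the subtraction from truncating, so there are exactly [p] blocks, padding
    included. *)
Record invariant (p : nat) (w : seq nat) (st : state) : Prop := Invariant {
  inv_total : Defs.total st = sumn w;
  inv_max : max_request st = \max_(x <- w) x;
  inv_flatten : flatten (blocks st) = w;
  inv_le : all (fun b => ((sumn b)%:R <= threshold p (Defs.total st) (max_request st))%R)
               (blocks st);
  inv_shape : exists bs, [/\ blocks st = bs ++ nseq (p - size bs) [::],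
                             all (fun b => 0 < size b) bs & size bs <= p]
}.

Lemma invariant_init (p : nat) : invariant p [::] (init p).
Proof.
split; rewrite /= ?big_nil //; first exact: flatten_nseq_nil.
  by rewrite all_nseq max_le_threshold orbT.
by exists [::]; rewrite /= subn0.
Qed.

Lemma sumn_flatten_sum (bs : seq (seq nat)) :
  sumn (flatten bs) = \sum_(b <- bs) sumn b.
Proof. by rewrite sumn_flatten sumnE big_map. Qed.

Lemma invariant_step (p : nat) (w : seq nat) (x : nat) (st : state) :
  0 < p -> positive_requests (rcons w x) ->
  invariant p w st -> invariant p (rcons w x) (step p st x).
Proof.
move=> p0 wx0 [totE maxE flatE st_le _].
rewrite /step -/(threshold p (Defs.total st + x) (maxn (max_request st) x)).
set B := threshold _ _ _; set gs := probe _ _ _.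
have elems_le : all (fun b => ((sumn b)%:R <= B)%R) (rcons (blocks st) [:: x]).
  rewrite all_rcons /= addn0 (le_trans _ (max_le_threshold _ _ _)); last first.
    by rewrite ler_nat leq_maxr.
  apply: sub_all st_le => b /le_trans; apply.
  by rewrite threshold_mono ?leq_addr ?leq_maxl.
have B0 : ((\sum_(z <- [::] : seq (seq nat)) sumn z)%:R <= B)%R.
  by rewrite big_nil (le_trans _ (max_le_threshold _ _ _)).
have sumE : \sum_(b <- [::] ++ rcons (blocks st) [:: x]) sumn b = Defs.total st + x.
  by rewrite cat0s -sumn_flatten_sum flatten_rcons flatE sumn_cat totE /= !addn0.
have sum0 : 0 < \sum_(b <- [::] ++ rcons (blocks st) [:: x]) sumn b.
  by move: wx0; rewrite sumE /positive_requests all_rcons => /andP[x0 _]; rewrite ltn_addl.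
have flat_gs : flatten gs = rcons (blocks st) [:: x] by exact: flatten_probe_from.
have size_gs : size gs <= p.
  have := size_probe_from B0 elems_le sum0.
  rewrite big_nil addr0 -/(probe _ _ _) -/gs sumE => lt_gs.
  have S_le : (2 * (Defs.total st + x)%:R <= p%:R * B)%R by exact: total_le_threshold.
  (* More than [p] groups would give [p <= (size gs).-1], hence [p * B <= (size gs).-1 * B], against
     the strict bound. *)
  rewrite leqNgt; apply: contraTN (lt_le_trans lt_gs S_le) => p_lt.
  rewrite -leNgt ler_wpM2r ?ler_nat //; last by lia.
  exact: le_trans (max_le_threshold _ _ _).
have flat_new : flatten (map flatten gs ++ nseq (p - size (map flatten gs)) [::]) = rcons w x.
  rewrite flatten_cat flatten_nseq_nil cats0 -flatten_flatten flat_gs.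
  by rewrite flatten_rcons flatE cats1.
split=> /=.
- by rewrite totE sumn_rcons.
- by rewrite maxE -cats1 big_cat big_seq1.
- exact: flat_new.
- rewrite all_cat all_nseq (le_trans _ (max_le_threshold _ _ _)) // orbT andbT all_map.
  apply: sub_all (probe_from_le B0 elems_le) => g /=.
  by rewrite sumn_flatten_sum.
exists (map flatten gs); split; rewrite ?size_map //.
rewrite all_map; apply: sub_all (probe_from_gt0 B0 elems_le sum0) => g /=.
by rewrite -sumn_flatten_sum; case: (flatten g).
Qed.

Lemma invariant_run (p : nat) (w : seq nat) :
  0 < p -> positive_requests w -> invariant p w (foldl (step p) (init p) w).
Proof.
move=> p0; elim/last_ind: w => [_|w x IHw wx0]; first exact: invariant_init.
rewrite -cats1 foldl_cat /= cats1; apply: invariant_step => //; apply: IHw.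
by move: wx0; rewrite /positive_requests all_rcons => /andP[].
Qed.

(** Probe only merges neighbours, so a prefix of the groups flattens to a prefix [L] of the old
    blocks followed by [[:: x]]. If [L] contains the final [[:: x]], its end is the end of the
    input, which is no separator; otherwise it ends at an old boundary or at [size w]. *)
Lemma separators_step (p : nat) (w : seq nat) (x : nat) (st : state) :
  invariant p w st ->
  {subset separators (blocks (step p st x)) <= size w :: separators (blocks st)}.
Proof.
move=> [_ _ flatE _ _] i /=; rewrite separators_cat_nseq.
set gs := probe _ _ _; case/mem_separators=> k ->.
have flat_gs : flatten gs = rcons (blocks st) [:: x] by exact: flatten_probe_from.
rewrite -map_take -!flatten_flatten flat_gs; set L := flatten (take k gs).
have {flat_gs} LE : L = take (size L) (rcons (blocks st) [:: x]).
  by rewrite -flat_gs -[gs](cat_take_drop k) flatten_cat take_size_cat.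
case: (leqP (size L) (size (blocks st))) => [L_le|L_gt]; last first.
  by rewrite {2}LE take_oversize ?size_rcons // ltnn andbF.
move: LE; rewrite -cats1 takel_cat // => LE /andP[L_gt0 _].
rewrite inE; have [//|L_neq] := eqVneq; apply/mem_separators.
exists (size L); first by rewrite -LE.
rewrite L_gt0 flatE ltn_neqAle L_neq LE -flatE.
by rewrite -{2}[blocks st](cat_take_drop (size L)) flatten_cat size_cat leq_addr.
Qed.

Theorem theorem9 (p : nat) (hp : 2 <= p) :
  preemptive p (online_probe p) /\ competitive 2%:R%R p (online_probe p).
Proof.
have p0 : 0 < p by apply: ltnW.
split; [split|] => w.
- move=> w0; have [_ _ flatE _ [bs [stE bs0 bsp]]] := invariant_run p0 w0.
  have flat_bs : flatten bs = w.
    rewrite -flatE stE flatten_cat; by rewrite flatten_nseq_nil cats0.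
  rewrite /online_probe stE separators_cat_nseq; split.
  + apply: sorted_filter; first exact: ltn_trans.
    by apply: (@path_sorted _ _ 0); apply: path_scanl_addn; rewrite all_map.
  + apply/allP => i; rewrite mem_filter flat_bs => /andP[/andP[-> /ltnW ->]].
    by [].
  (* Nonempty blocks have one separator fewer than there are blocks, hence at most [p.-1]; the empty
     list is treated apart. *)
  case: (posnP (size bs)) => [/size0nil -> //|bs_gt0].
  have /(congr1 size) := rcons_separators bs0 bs_gt0.
  by rewrite size_rcons size_scanl size_map; lia.
- move=> x wx0; rewrite /online_probe -cats1 foldl_cat /=.
  apply: separators_step; apply: invariant_run => //.
  by move: wx0; rewrite /positive_requests all_rcons => /andP[].
move=> w0; have [totE maxE flatE st_le [bs [stE bs0 bsp]]] := invariant_run p0 w0.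
have flat_bs : flatten bs = w.
  rewrite -flatE stE flatten_cat; by rewrite flatten_nseq_nil cats0.
rewrite -natrM ler_nat /online_probe stE separators_cat_nseq.
rewrite -{1}flat_bs; apply: bottleneck_separators => //.
move: st_le; rewrite stE all_cat totE maxE => /andP[+ _]; apply: sub_all => b /=.
by move=> /le_trans /(_ (threshold_le_opt w p0)); rewrite ler_nat.
Qed.
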